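(* Let $a=(a_k)_{k\in\mathbb{N}}\in\ell^\infty$ be a bounded complex sequence. Then $$\lim_{n\to\infty}\ \sup_{j\in\mathbb{N}}\ \frac1n\sum_{k=1}^{n}|a_{k+j-1}|\ \le\ \|a\|_w .$$
   Context: $\mathbb{N}=\{1,2,3,\dots\}$. $\ell^2$ is the complex Hilbert space of square-summable unilateral sequences $(x_k)_{k\in\mathbb{N}}$, and $\ell^\infty$ the complex Banach space of bounded complex sequences $(a_k)_{k\in\mathbb{N}}$ with the uniform norm $\|\cdot\|_\infty$. For $a\in\ell^\infty$, the (unilateral) weighted forward shift $T_a:\ell^2\to\ell^2$ is the bounded operator $T_a(x_1,x_2,\dots)=(0,a_1x_1,a_2x_2,\dots)$. The numerical radius of a bounded operator $T$ on a complex Hilbert space $H$ is $w(T)=\sup\{|\langle Tx,x\rangle| : x\in H,\ \|x\|=1\}$. For $a\in\ell^\infty$ set $\|a\|_w:=w(T_a)$; this is a norm on $\ell^\infty$. (The limit on the left-hand side exists for every bounded sequence.) *)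

(* Defs.v *)
(* Concrete real numbers of Stdlib, with Coquelicot's complex numbers, series and
   limits.  Sequences are functions on [nat]: the entry with (1-based) index k of
   the mathematical sequence is the value at k - 1. *)
From Stdlib Require Import Reals Lra Lia.
From Coquelicot Require Import Coquelicot.
Open Scope R_scope.

Record ell2 : Type := MkEll2 {
  ell2_seq :> nat -> C;
  ell2_summable : ex_series (fun k => Cmod (ell2_seq k) ^ 2)
}.

Record ellinf : Type := MkEllinf {
  ellinf_seq :> nat -> C;
  ellinf_bounded : exists M : R, forall k, Cmod (ellinf_seq k) <= M
}.

Definition CSeries (u : nat -> C) : C :=
  (Series (fun k => Re (u k)), Series (fun k => Im (u k))).

(* Linear in the first argument; the series converges absolutely, see
   [ex_series_inner] below. *)
Definition inner (x y : ell2) : C := CSeries (fun k => (x k * Cconj (y k))%C).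

Definition ell2_norm (x : ell2) : R := sqrt (Series (fun k => Cmod (x k) ^ 2)).

Definition shift_seq (a x : nat -> C) (k : nat) : C :=
  match k with
  | O => 0%C
  | S m => (a m * x m)%C
  end.

Lemma shift_summable (a : ellinf) (x : ell2) :
  ex_series (fun k => Cmod (shift_seq a x k) ^ 2).
Proof.
destruct (ellinf_bounded a) as [M HM].
apply ex_series_incr_1; simpl shift_seq.
apply (ex_series_le (V := R_CompleteNormedModule)) with
  (b := fun k => M ^ 2 * Cmod (x k) ^ 2).
- intros k. change (Rabs (Cmod (a k * x k) ^ 2) <= M ^ 2 * Cmod (x k) ^ 2).
  rewrite Rabs_pos_eq by apply pow2_ge_0.
  rewrite Cmod_mult, Rpow_mult_distr.
  apply Rmult_le_compat_r; [apply pow2_ge_0|].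
  apply pow_incr; split; [apply Cmod_ge_0 | apply HM].
- apply (ex_series_scal (V := R_NormedModule)), ell2_summable.
Qed.

Definition weighted_shift (a : ellinf) (x : ell2) : ell2 :=
  MkEll2 (shift_seq a x) (shift_summable a x).

Definition numerical_radius (T : ell2 -> ell2) : Rbar :=
  Lub_Rbar (fun r => exists x : ell2, ell2_norm x = 1 /\ r = Cmod (inner (T x) x)).

(* The numerical radius of a weighted shift is finite
   ([numerical_radius_shift_finite]), so no information is lost here. *)
Definition norm_w (a : ellinf) : R := real (numerical_radius (weighted_shift a)).

(* With 1-based index j' = j + 1, this is (1/n) sum_{k=1}^n |a_{k+j'-1}|.  The
   value at n = 0 is 0 and does not affect limits in n. *)
Definition block_mean (a : ellinf) (n j : nat) : R :=
  / INR n * sum_n_m (fun k => Cmod (a (Nat.pred k + j)%nat)) 1 n.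

(* The supremum is finite, see [Sup_block_mean_finite]. *)
Definition sup_block_mean (a : ellinf) (n : nat) : R :=
  real (Sup_seq (fun j => Finite (block_mean a n j))).

Lemma ex_series_inner (x y : ell2) :
  ex_series (fun k => Cmod (x k * Cconj (y k))%C).
Proof.
apply (ex_series_le (V := R_CompleteNormedModule)) with
  (b := fun k => Cmod (x k) ^ 2 + Cmod (y k) ^ 2).
- intros k. change (Rabs (Cmod (x k * Cconj (y k))) <= Cmod (x k) ^ 2 + Cmod (y k) ^ 2).
  rewrite Rabs_pos_eq by apply Cmod_ge_0.
  rewrite Cmod_mult, Cmod_conj.
  pose proof (Cmod_ge_0 (x k)); pose proof (Cmod_ge_0 (y k)); nra.
- apply (ex_series_plus (V := R_NormedModule)); apply ell2_summable.
Qed.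

Lemma Series_abs_le (u : nat -> R) (v : nat -> R) :
  (forall k, Rabs (u k) <= v k) -> ex_series v -> Rabs (Series u) <= Series v.
Proof.
intros Huv Hv.
apply Rle_trans with (Series (fun k => Rabs (u k))).
- apply Series_Rabs.
  apply (ex_series_le (V := R_CompleteNormedModule)) with (b := v); [|exact Hv].
  intros k. change (Rabs (Rabs (u k)) <= v k). now rewrite Rabs_Rabsolu.
- apply Series_le; [|exact Hv]. intros k; split; [apply Rabs_pos | apply Huv].
Qed.

Lemma im_le_Cmod' (c : C) : Rabs (Im c) <= Cmod c.
Proof.
apply Rle_trans with (2 := Rmax_Cmod c). apply Rmax_r.
Qed.

Lemma Cmod_inner_le (x y : ell2) :
  Cmod (inner x y) <=
  2 * (Series (fun k => Cmod (x k) ^ 2) + Series (fun k => Cmod (y k) ^ 2)).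
Proof.
set (b := fun k => Cmod (x k) ^ 2 + Cmod (y k) ^ 2).
assert (Hb : ex_series b)
  by (apply (ex_series_plus (V := R_NormedModule)); apply ell2_summable).
assert (Hxy : forall k, Cmod (x k * Cconj (y k))%C <= b k).
{ intros k; unfold b; rewrite Cmod_mult, Cmod_conj.
  pose proof (Cmod_ge_0 (x k)); pose proof (Cmod_ge_0 (y k)); nra. }
rewrite <- Series_plus by apply ell2_summable. fold b.
assert (HR : Rabs (Re (inner x y)) <= Series b).
{ apply Series_abs_le; [|exact Hb]. intros k.
  eapply Rle_trans; [apply re_le_Cmod | apply Hxy]. }
assert (HI : Rabs (Im (inner x y)) <= Series b).
{ apply Series_abs_le; [|exact Hb]. intros k.
  eapply Rle_trans; [apply im_le_Cmod' | apply Hxy]. }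
pose proof (Rabs_pos (Re (inner x y))). pose proof (Rabs_pos (Im (inner x y))).
apply Rsqr_incr_0_var; [|lra].
rewrite Rsqr_pow2, Cmod2_alt, <- (pow2_abs (Re _)), <- (pow2_abs (Im _)).
unfold Rsqr; nra.
Qed.

Lemma unit_vector_exists : exists x : ell2, ell2_norm x = 1.
Proof.
set (e := fun k : nat => match k with O => RtoC 1 | S _ => RtoC 0 end).
assert (He : is_series (fun k => Cmod (e k) ^ 2) 1).
{ apply is_series_decr_1. simpl e. rewrite Cmod_1.
  match goal with |- is_series _ ?l =>
    replace l with 0 by (unfold plus, opp; simpl; ring) end.
  apply (is_series_ext (fun _ : nat => 0)).
  - intros _; rewrite Cmod_0; simpl; ring.
  - unfold is_series. apply filterlim_ext with (fun _ : nat => 0).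
    + intros n; rewrite sum_n_const; ring.
    + apply filterlim_const. }
exists (MkEll2 e (ex_intro _ 1 He)).
unfold ell2_norm; simpl ell2_seq.
rewrite (is_series_unique _ _ He). apply sqrt_1.
Qed.

Lemma numerical_radius_shift_finite (a : ellinf) :
  is_finite (numerical_radius (weighted_shift a)).
Proof.
unfold numerical_radius.
match goal with |- is_finite (Lub_Rbar ?E) => set (E0 := E) end.
destruct (Lub_Rbar_correct E0) as [Hub Hlub].
destruct (ellinf_bounded a) as [M HM].
destruct unit_vector_exists as [e He].
apply is_finite_correct.
assert (Hle : Rbar_le (Lub_Rbar E0) (2 * (M ^ 2 + 1))).
{ apply Hlub. intros r [x [Hx ->]].
  assert (Sx : Series (fun k => Cmod (x k) ^ 2) = 1).
  { unfold ell2_norm in Hx.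
    destruct (Rle_dec 0 (Series (fun k => Cmod (x k) ^ 2))) as [H0|H0].
    - rewrite <- (sqrt_sqrt _ H0), Hx; ring.
    - rewrite sqrt_neg_0 in Hx; lra. }
  simpl. eapply Rle_trans; [apply Cmod_inner_le|].
  rewrite Sx. apply Rmult_le_compat_l; [lra|]. apply Rplus_le_compat_r.
  rewrite Series_incr_1 by apply ell2_summable. simpl ell2_seq; simpl shift_seq.
  rewrite Cmod_0.
  assert (Series (fun k => Cmod (a k * x k) ^ 2) <=
          Series (fun k => M ^ 2 * Cmod (x k) ^ 2)).
  { apply Series_le.
    - intros k; split; [apply pow2_ge_0|].
      rewrite Cmod_mult, Rpow_mult_distr.
      apply Rmult_le_compat_r; [apply pow2_ge_0|].
      apply pow_incr; split; [apply Cmod_ge_0 | apply HM].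
    - apply (ex_series_scal (V := R_NormedModule)), ell2_summable. }
  rewrite Series_scal_l, Sx in H. lra. }
assert (Hge : Rbar_le (Cmod (inner (weighted_shift a e) e)) (Lub_Rbar E0)).
{ apply Hub. exists e; split; [exact He | reflexivity]. }
destruct (Lub_Rbar E0) as [l| |]; [now exists l | easy | easy].
Qed.

Lemma Sup_block_mean_finite (a : ellinf) (n : nat) :
  is_finite (Sup_seq (fun j => Finite (block_mean a n j))).
Proof.
destruct (ellinf_bounded a) as [M HM].
apply is_finite_correct.
assert (Hle : Rbar_le (Sup_seq (fun j => Finite (block_mean a n j)))
                      (/ INR n * (INR n * M))).
{ apply (is_sup_seq_lub _ _ (Sup_seq_correct _)).
  intros x [j ->]. simpl. unfold block_mean.
  apply Rmult_le_compat_l.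
  - destruct n as [|n]; [simpl; rewrite Rinv_0; lra|].
    apply Rlt_le, Rinv_0_lt_compat, lt_0_INR; lia.
  - apply Rle_trans with (sum_n_m (fun _ => M) 1 n).
    + apply sum_n_m_le. intros k; apply HM.
    + rewrite sum_n_m_const. replace (S n - 1)%nat with n by lia. lra. }
pose proof (is_sup_seq_major _ _ 0%nat
  (Sup_seq_correct (fun j => Finite (block_mean a n j)))) as Hge.
destruct (Sup_seq (fun j => Finite (block_mean a n j))) as [l| |];
  [now exists l | easy | easy].
Qed.

(* Main.v *)
Require Import Defs.
From Stdlib Require Import Reals Lra Lia.
From Coquelicot Require Import Coquelicot.
Open Scope R_scope.

(** Write S n for the supremum over j of the sums |a_j| + ... + |a_(j+n-1)|.

    Splitting a block of length m + n into two consecutive blocks shows that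
    S is subadditive, so S n / n converges by Fekete's lemma
    ([subadditive_mean_converges]).

    For the bound, fix a window of n + 1 consecutive indices starting at j and
    take the unit vector whose entries there have modulus 1 / sqrt (n + 1) and
    vanish elsewhere.  Its phases can be chosen recursively so that every term
    of <T_a x, x> is nonnegative ([phase_aligned]); the inner product then equals
    (|a_j| + ... + |a_(j+n-1)|) / (n + 1), because only n of the n + 1 entries
    are followed by another one of the window.  Hence S n <= (n + 1) w(T_a)
    ([block_sum_le_norm_w]), and dividing by n and letting n tend to infinity
    gives the inequality. *)

(** * Sums over blocks of consecutive indices *)

Definition block_sum (u : nat -> R) (n j : nat) : R :=
  sum_n_m (fun k => u (Nat.pred k + j)%nat) 1 n.

Lemma block_sum_0 (u : nat -> R) (j : nat) : block_sum u 0 j = 0.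
Proof. unfold block_sum. now rewrite sum_n_m_zero by lia. Qed.

Lemma block_sum_S (u : nat -> R) (n j : nat) :
  block_sum u (S n) j = block_sum u n j + u (n + j)%nat.
Proof. unfold block_sum. now rewrite sum_n_Sm by lia. Qed.

Lemma block_sum_add (u : nat -> R) (m n j : nat) :
  block_sum u (m + n) j = block_sum u m j + block_sum u n (m + j).
Proof.
induction n as [|n IH].
- rewrite Nat.add_0_r, block_sum_0; ring.
- rewrite Nat.add_succ_r, !block_sum_S, IH.
  replace (m + n + j)%nat with (n + (m + j))%nat by lia. ring.
Qed.

Lemma block_sum_ext (u v : nat -> R) (n j : nat) :
  (forall k, (k < n)%nat -> u (k + j)%nat = v (k + j)%nat) ->
  block_sum u n j = block_sum v n j.
Proof.
induction n as [|n IH]; intros Huv.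
- now rewrite !block_sum_0.
- rewrite !block_sum_S, (Huv n), IH by (auto with arith). reflexivity.
Qed.

Lemma block_sum_scal (c : R) (u : nat -> R) (n j : nat) :
  block_sum (fun k => c * u k) n j = c * block_sum u n j.
Proof.
induction n as [|n IH]; rewrite ?block_sum_0, ?block_sum_S, ?IH; ring.
Qed.

Lemma block_sum_const (c : R) (n j : nat) :
  block_sum (fun _ => c) n j = INR n * c.
Proof.
induction n as [|n IH]; rewrite ?block_sum_0, ?block_sum_S, ?IH, ?S_INR;
  simpl; ring.
Qed.

Lemma is_series_block (f : nat -> R) (n j : nat) :
  (forall k, (k < j \/ n + j <= k)%nat -> f k = 0) ->
  is_series f (block_sum f n j).
Proof.
intros Hf.
(* Comparing with the block that starts at index 0 turns the partial sums of the
   series into block sums. *)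
assert (Hpre : forall m, (m <= j)%nat -> block_sum f m 0 = 0).
{ intros m Hm. rewrite (block_sum_ext _ (fun _ => 0)).
  - rewrite block_sum_const; ring.
  - intros k Hk; apply Hf; lia. }
assert (Hsum : forall N, sum_n f N = block_sum f (S N) 0).
{ induction N as [|N IH].
  - rewrite sum_O, block_sum_S, block_sum_0; simpl; ring.
  - rewrite sum_Sn, IH, (block_sum_S _ (S N)), Nat.add_0_r. reflexivity. }
change (is_lim_seq (sum_n f) (block_sum f n j)).
apply (is_lim_seq_ext_loc (fun _ => block_sum f n j)); [|apply is_lim_seq_const].
exists (n + j)%nat. intros N HN. rewrite Hsum.
replace (S N) with (j + (n + (S N - (n + j))))%nat by lia.
rewrite block_sum_add, Hpre, block_sum_add, Nat.add_0_r by lia.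
rewrite (block_sum_ext f (fun _ => 0) (S N - (n + j))).
- rewrite block_sum_const; ring.
- intros k _; apply Hf; lia.
Qed.

(** * Fekete's lemma *)

Lemma subadditive_mult_le (g : nat -> R) (m q r : nat) :
  (forall p n, g (p + n)%nat <= g p + g n) ->
  g (q * m + r)%nat <= INR q * g m + g r.
Proof.
intros Hsub. induction q as [|q IH].
- simpl; lra.
- rewrite S_INR. replace (S q * m + r)%nat with (m + (q * m + r))%nat by lia.
  specialize (Hsub m (q * m + r)%nat). lra.
Qed.

(** Fekete's lemma under a linear bound: the means converge to their infimum.
    If the mean s m is within eps of the infimum, writing n = q m + r gives
    s n <= s m + m M / n, as the remainder of length r < m costs at most m M. *)
Lemma subadditive_mean_converges (s : nat -> R) (M : R) :
  (forall n, 0 <= s n <= M) ->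
  (forall m n, INR (m + n) * s (m + n)%nat <= INR m * s m + INR n * s n) ->
  exists l : R, is_lim_seq s l.
Proof.
intros Hs Hsub.
destruct (completeness (fun r => exists n, r = - s (S n))) as [b [Hub Hlub]].
{ exists 0. intros r [n ->]. specialize (Hs (S n)); lra. }
{ exists (- s 1%nat), 0%nat; reflexivity. }
assert (Hinf : forall n, (0 < n)%nat -> - b <= s n).
{ intros [|n] Hn; [lia|]. assert (- s (S n) <= b) by (apply Hub; now exists n). lra. }
assert (Happrox : forall eps, 0 < eps -> exists m, (0 < m)%nat /\ s m < - b + eps).
{ intros eps Heps.
  destruct (Classical_Prop.classic (exists m, (0 < m)%nat /\ s m < - b + eps))
    as [H|H]; [exact H|exfalso].
  assert (b <= b - eps); [|lra].
  apply Hlub. intros r [n ->].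
  destruct (Rlt_dec (s (S n)) (- b + eps)) as [Hlt|Hlt]; [|lra].
  exfalso; apply H; exists (S n); split; [lia|exact Hlt]. }
exists (- b). apply is_lim_seq_spec. intros eps.
pose proof (cond_pos eps) as Heps.
destruct (Happrox (eps / 2)) as [m [Hm0 Hm]]; [lra|].
assert (HM : 0 <= M) by (specialize (Hs 0%nat); lra).
assert (HmM : 0 <= INR m * M) by (apply Rmult_le_pos; [apply pos_INR | exact HM]).
destruct (INR_unbounded (INR m * M / (eps / 2))) as [N HN].
exists (S N). intros n Hn.
assert (Hn0 : 0 < INR n) by (apply lt_0_INR; lia).
specialize (Hinf n ltac:(lia)).
assert (Hub' : INR n * s n <= INR n * s m + INR m * M).
{ pose proof (Nat.div_mod_eq n m) as Hdiv.
  pose proof (Nat.mod_upper_bound n m ltac:(lia)) as Hr.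
  set (q := (n / m)%nat) in *. set (r := (n mod m)%nat) in *.
  pose proof (subadditive_mult_le (fun k => INR k * s k) m q r Hsub) as Hq.
  cbv beta in Hq.
  replace (q * m + r)%nat with n in Hq by lia.
  assert (INR q * (INR m * s m) <= INR n * s m).
  { rewrite <- Rmult_assoc, <- mult_INR. apply Rmult_le_compat_r; [apply Hs|].
    apply le_INR; lia. }
  assert (INR r * s r <= INR m * M).
  { apply Rmult_le_compat; [apply pos_INR | apply Hs | apply le_INR; lia | apply Hs]. }
  lra. }
assert (Hsmall : INR m * M < INR n * (eps / 2)).
{ apply Rlt_div_l in HN; [|lra].
  apply Rlt_le_trans with (1 := HN). apply Rmult_le_compat_r; [lra|].
  apply le_INR; lia. }
assert (s n < s m + eps / 2) by (apply (Rmult_lt_reg_l (INR n)); lra).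
apply Rabs_def1; lra.
Qed.

(** * Test vectors for the numerical radius *)

(** The value 1 at z = 0 keeps the modulus equal to 1, so that a vanishing weight
    does not change the norm of the test vector. *)
Definition unit_phase (z : C) : C :=
  if Req_dec_T (Cmod z) 0 then RtoC 1 else (z / RtoC (Cmod z))%C.

Lemma Cmod_unit_phase (z : C) : Cmod (unit_phase z) = 1.
Proof.
unfold unit_phase. destruct (Req_dec_T (Cmod z) 0) as [H|H].
- apply Cmod_1.
- rewrite Cmod_div.
  + rewrite Cmod_R, Rabs_pos_eq by apply Cmod_ge_0. now field.
  + intros E; apply RtoC_inj in E; contradiction.
Qed.

Lemma Cconj_RtoC (r : R) : Cconj (RtoC r) = RtoC r.
Proof. unfold Cconj, RtoC; simpl. now rewrite Ropp_0. Qed.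

Lemma unit_phase_spec (z : C) : (z * Cconj (unit_phase z) = RtoC (Cmod z))%C.
Proof.
unfold unit_phase. destruct (Req_dec_T (Cmod z) 0) as [H|H].
- rewrite H. apply Cmod_eq_0 in H. rewrite H. ring.
- unfold Cdiv. rewrite Cmult_conj, <- RtoC_inv by exact H.
  rewrite Cconj_RtoC, Cmult_assoc, <- Cmod2_conj.
  rewrite <- RtoC_mult. f_equal. now field.
Qed.

Fixpoint aligned_phase (a : nat -> C) (k : nat) : C :=
  match k with
  | O => RtoC 1
  | S m => (unit_phase (a m) * aligned_phase a m)%C
  end.

Lemma Cmod_aligned_phase (a : nat -> C) (k : nat) : Cmod (aligned_phase a k) = 1.
Proof.
induction k as [|k IH]; simpl.
- apply Cmod_1.
- rewrite Cmod_mult, IH, Cmod_unit_phase; ring.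
Qed.

(** Passing from index k to k + 1 multiplies the phase by that of a_k, and the
    conjugation in the inner product turns this factor into its inverse. *)
Lemma phase_aligned (a : nat -> C) (k : nat) :
  (a k * aligned_phase a k * Cconj (aligned_phase a (S k)) = RtoC (Cmod (a k)))%C.
Proof.
simpl. rewrite Cmult_conj.
replace (a k * aligned_phase a k * (Cconj (unit_phase (a k)) * Cconj (aligned_phase a k)))%C
  with ((a k * Cconj (unit_phase (a k))) * (aligned_phase a k * Cconj (aligned_phase a k)))%C
  by ring.
rewrite unit_phase_spec, <- Cmod2_conj, Cmod_aligned_phase.
rewrite <- RtoC_mult. f_equal. ring.
Qed.

Definition window (c : R) (n j k : nat) : R :=
  if andb (Nat.leb j k) (Nat.ltb k (n + j)) then c else 0.

Lemma window_in (c : R) (n j k : nat) :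
  (k < n)%nat -> window c n j (k + j) = c.
Proof.
intros Hk. unfold window.
destruct (Nat.leb_spec j (k + j)), (Nat.ltb_spec (k + j) (n + j)); simpl; lia || easy.
Qed.

Lemma window_out (c : R) (n j k : nat) :
  (k < j \/ n + j <= k)%nat -> window c n j k = 0.
Proof.
intros Hk. unfold window.
destruct (Nat.leb_spec j k), (Nat.ltb_spec k (n + j)); simpl; lia || easy.
Qed.

Definition test_seq (a : nat -> C) (c : R) (n j k : nat) : C :=
  (RtoC (window c n j k) * aligned_phase a k)%C.

Lemma is_series_test_seq (a : nat -> C) (c : R) (n j : nat) :
  is_series (fun k => Cmod (test_seq a c n j k) ^ 2) (INR n * c ^ 2).
Proof.
apply (is_series_ext (fun k => window c n j k ^ 2)).
{ intros k. unfold test_seq.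
  rewrite Cmod_mult, Cmod_aligned_phase, Cmod_R, Rmult_1_r. now rewrite pow2_abs. }
rewrite <- (block_sum_const (c ^ 2) n j).
rewrite <- (block_sum_ext (fun k => window c n j k ^ 2)).
- apply is_series_block. intros k Hk. rewrite window_out by exact Hk. ring.
- intros k Hk. now rewrite window_in.
Qed.

Definition test_vector (a : nat -> C) (c : R) (n j : nat) : ell2 :=
  MkEll2 (test_seq a c n j) (ex_intro _ _ (is_series_test_seq a c n j)).

Lemma Series_0_const : Series (fun _ => 0) = 0.
Proof.
apply is_series_unique.
assert (H := is_series_block (fun _ => 0) 0 0 (fun _ _ => eq_refl)).
now rewrite block_sum_0 in H.
Qed.

Lemma inner_test_vector (a : ellinf) (c : R) (n j : nat) :
  inner (weighted_shift a (test_vector a c (S n) j)) (test_vector a c (S n) j)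
  = RtoC (c ^ 2 * block_sum (fun k => Cmod (a k)) n j).
Proof.
unfold inner, CSeries, weighted_shift, test_vector; simpl ell2_seq.
set (w := window c (S n) j).
assert (Hterm : forall k,
  (shift_seq a (test_seq a c (S n) j) (S k) * Cconj (test_seq a c (S n) j (S k)))%C
  = RtoC (w k * w (S k) * Cmod (a k))).
{ intros k. unfold test_seq; fold w.
  change (shift_seq a (fun k => (w k * aligned_phase a k)%C) (S k))
    with (a k * (w k * aligned_phase a k))%C.
  rewrite Cmult_conj, Cconj_RtoC, !RtoC_mult, <- phase_aligned. ring. }
(* The 0-th entry of the shifted vector vanishes, so both series start at 1. *)
rewrite (Series_incr_1_aux (fun k => Re _)) by (simpl; ring).
rewrite (Series_incr_1_aux (fun k => Im _)) by (simpl; ring).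
unfold RtoC at 1. f_equal.
- rewrite (Series_ext _ (fun k => w k * w (S k) * Cmod (a k)))
    by (intros k; now rewrite Hterm).
  rewrite <- block_sum_scal. apply is_series_unique.
  (* The product of two neighbouring entries is nonzero only at the first n
     indices of the window of length n + 1. *)
  rewrite <- (block_sum_ext (fun k => w k * w (S k) * Cmod (a k))).
  + apply is_series_block. intros k Hk. unfold w. destruct Hk as [Hk|Hk].
    * rewrite (window_out _ _ _ k) by lia. ring.
    * rewrite (window_out _ _ _ (S k)) by lia. ring.
  + intros k Hk. unfold w.
    change (S (k + j)) with (S k + j)%nat. rewrite !window_in by lia. ring.
- rewrite (Series_ext _ (fun _ => 0)) by (intros k; now rewrite Hterm).
  apply Series_0_const.
Qed.

Lemma Cmod_inner_le_norm_w (a : ellinf) (x : ell2) :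
  ell2_norm x = 1 -> Cmod (inner (weighted_shift a x) x) <= norm_w a.
Proof.
intros Hx. unfold norm_w.
change (Rbar_le (Cmod (inner (weighted_shift a x) x))
                (real (numerical_radius (weighted_shift a)))).
rewrite numerical_radius_shift_finite.
apply Lub_Rbar_correct. now exists x.
Qed.

(** The flat test vector on n + 1 consecutive indices, of modulus
    1 / sqrt (n + 1), realizes the block sum divided by n + 1. *)
Lemma block_sum_le_norm_w (a : ellinf) (n j : nat) :
  block_sum (fun k => Cmod (a k)) n j <= INR (S n) * norm_w a.
Proof.
pose proof (lt_0_INR (S n) ltac:(lia)) as HN.
set (c := sqrt (/ INR (S n))).
assert (Hc : c ^ 2 = / INR (S n))
  by (apply pow2_sqrt, Rlt_le, Rinv_0_lt_compat, HN).
assert (Hnorm : ell2_norm (test_vector a c (S n) j) = 1).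
{ unfold ell2_norm, test_vector; simpl ell2_seq.
  rewrite (is_series_unique _ _ (is_series_test_seq a c (S n) j)), Hc.
  rewrite Rinv_r by lra. apply sqrt_1. }
apply (Cmod_inner_le_norm_w a) in Hnorm.
rewrite inner_test_vector, Cmod_R, Hc in Hnorm.
apply (Rle_trans _ _ _ (Rle_abs _)) in Hnorm.
apply (Rmult_le_compat_l (INR (S n))) in Hnorm; [|lra].
rewrite <- Rmult_assoc, Rinv_r, Rmult_1_l in Hnorm by lra. exact Hnorm.
Qed.

(** * Suprema of block means *)

Lemma block_mean_le_sup (a : ellinf) (n j : nat) :
  block_mean a n j <= sup_block_mean a n.
Proof.
unfold sup_block_mean.
change (Rbar_le (block_mean a n j)
                (real (Sup_seq (fun j => Finite (block_mean a n j))))).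
rewrite Sup_block_mean_finite.
apply (is_sup_seq_major (fun j => Finite (block_mean a n j)) _ j), Sup_seq_correct.
Qed.

Lemma sup_block_mean_lub (a : ellinf) (n : nat) (B : R) :
  (forall j, block_mean a n j <= B) -> sup_block_mean a n <= B.
Proof.
intros HB. unfold sup_block_mean.
change (Rbar_le (real (Sup_seq (fun j => Finite (block_mean a n j)))) B).
rewrite Sup_block_mean_finite.
apply (is_sup_seq_lub _ _ (Sup_seq_correct _)).
intros x [j ->]. apply HB.
Qed.

Lemma block_sum_le_sup (a : ellinf) (n j : nat) :
  block_sum (fun k => Cmod (a k)) n j <= INR n * sup_block_mean a n.
Proof.
destruct n as [|n].
- rewrite block_sum_0; simpl; lra.
- pose proof (lt_0_INR (S n) ltac:(lia)) as HN.
  apply Rle_trans with (INR (S n) * block_mean a (S n) j).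
  + unfold block_mean. fold (block_sum (fun k => Cmod (a k)) (S n) j).
    rewrite <- Rmult_assoc, Rinv_r by lra. lra.
  + apply Rmult_le_compat_l; [lra|]. apply block_mean_le_sup.
Qed.

Lemma mult_sup_block_mean_lub (a : ellinf) (n : nat) (B : R) :
  (forall j, block_sum (fun k => Cmod (a k)) n j <= B) ->
  INR n * sup_block_mean a n <= B.
Proof.
intros HB. destruct n as [|n].
- specialize (HB 0%nat). rewrite block_sum_0 in HB. simpl; lra.
- pose proof (lt_0_INR (S n) ltac:(lia)) as HN.
  apply (Rmult_le_reg_l (/ INR (S n))); [now apply Rinv_0_lt_compat|].
  rewrite <- Rmult_assoc, Rinv_l, Rmult_1_l by lra.
  apply sup_block_mean_lub. intros j.
  apply Rmult_le_compat_l; [now apply Rlt_le, Rinv_0_lt_compat|]. apply HB.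
Qed.

Lemma sup_block_mean_subadditive (a : ellinf) (m n : nat) :
  INR (m + n) * sup_block_mean a (m + n)
  <= INR m * sup_block_mean a m + INR n * sup_block_mean a n.
Proof.
apply mult_sup_block_mean_lub. intros j. rewrite block_sum_add.
apply Rplus_le_compat; apply block_sum_le_sup.
Qed.

Lemma sup_block_mean_0 (a : ellinf) : sup_block_mean a 0 = 0.
Proof.
assert (H0 : forall j, block_mean a 0 j = 0).
{ intros j. unfold block_mean. fold (block_sum (fun k => Cmod (a k)) 0 j).
  rewrite block_sum_0; ring. }
apply Rle_antisym.
- apply sup_block_mean_lub. intros j; rewrite H0; lra.
- rewrite <- (H0 0%nat). apply block_mean_le_sup.
Qed.

Lemma block_sum_Cmod_ge_0 (a : nat -> C) (n j : nat) :
  0 <= block_sum (fun k => Cmod (a k)) n j.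
Proof.
induction n as [|n IH]; rewrite ?block_sum_0, ?block_sum_S; [lra|].
pose proof (Cmod_ge_0 (a (n + j)%nat)); lra.
Qed.

Lemma sup_block_mean_ge_0 (a : ellinf) (n : nat) : 0 <= sup_block_mean a n.
Proof.
destruct n as [|n]; [rewrite sup_block_mean_0; lra|].
apply (Rmult_le_reg_l (INR (S n))); [apply lt_0_INR; lia|].
rewrite Rmult_0_r.
apply Rle_trans with (2 := block_sum_le_sup a (S n) 0), block_sum_Cmod_ge_0.
Qed.

Lemma sup_block_mean_S_le (a : ellinf) (n : nat) :
  sup_block_mean a (S n) <= (1 + / INR (S n)) * norm_w a.
Proof.
pose proof (lt_0_INR (S n) ltac:(lia)) as HN.
apply (Rmult_le_reg_l (INR (S n))); [exact HN|].
replace (INR (S n) * ((1 + / INR (S n)) * norm_w a))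
  with (INR (S (S n)) * norm_w a)
  by (rewrite (S_INR (S n)); field; lra).
apply mult_sup_block_mean_lub. intros j. apply block_sum_le_norm_w.
Qed.

Lemma norm_w_ge_0 (a : ellinf) : 0 <= norm_w a.
Proof.
pose proof (block_sum_le_norm_w a 0 0) as H.
rewrite block_sum_0, INR_1 in H. lra.
Qed.

(** * The inequality *)

Theorem theorem2p1 (a : ellinf) :
  exists l : R, is_lim_seq (sup_block_mean a) l /\ l <= norm_w a.
Proof.
destruct (subadditive_mean_converges (sup_block_mean a) (2 * norm_w a)) as [l Hl].
- intros n. split; [apply sup_block_mean_ge_0|].
  pose proof (norm_w_ge_0 a) as Hw.
  destruct n as [|n]; [rewrite sup_block_mean_0; lra|].
  apply Rle_trans with (1 := sup_block_mean_S_le a n).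
  apply Rmult_le_compat_r; [exact Hw|].
  assert (/ INR (S n) <= / 1); [|lra].
  apply Rinv_le_contravar; [lra|]. rewrite <- INR_1. apply le_INR; lia.
- apply sup_block_mean_subadditive.
- exists l. split; [exact Hl|].
  change (Rbar_le l (norm_w a)).
  apply (is_lim_seq_le (fun n => sup_block_mean a (S n))
                       (fun n => (1 + / INR (S n)) * norm_w a)).
  + apply sup_block_mean_S_le.
  + now apply is_lim_seq_incr_1 in Hl.
  + replace (Finite (norm_w a)) with (Rbar_mult (Finite (1 + 0)) (Finite (norm_w a)))
      by (simpl; f_equal; ring).
    apply is_lim_seq_scal_r.
    apply is_lim_seq_plus'; [apply is_lim_seq_const|].
    apply (is_lim_seq_incr_1 (fun n => / INR n)).
    apply (is_lim_seq_inv _ p_infty); [apply is_lim_seq_INR | easy].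
Qed.
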